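(* Let $\varphi$ be a nondecreasing function defined on $(0,\infty)$ such that $t\mapsto\varphi(e^t)$ is convex on $\mathbb{R}$. Let $A_1,\ldots,A_m\in\mathbb{P}_n$ and let $X_1,\ldots,X_m\in\mathbb{M}_n$ be invertible. Then the map $$(t_1,\ldots,t_m)\mapsto \mathrm{Tr}\,\varphi\Big(\sum_{i=1}^m X_i^*A_i^{t_i}X_i\Big)$$ is jointly convex on $\mathbb{R}^m$.
   Context: $\mathbb{M}_n$ denotes the space of $n\times n$ complex matrices and $\mathbb{P}_n$ the cone of positive definite matrices in $\mathbb{M}_n$. For $A\in\mathbb{P}_n$ and $t\in\mathbb{R}$, $A^t$ is defined by functional calculus, and for a Hermitian positive definite matrix $H$, $\varphi(H)$ is defined by functional calculus. $\mathrm{Tr}$ is the trace. *)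

(* Defs.v *)
From Stdlib Require Import Reals Lra ClassicalEpsilon.
Open Scope R_scope.

Record C := mkC { Cre : R; Cim : R }.
Definition C0 : C := mkC 0 0.
Definition C1 : C := mkC 1 0.
Definition RtoC (x : R) : C := mkC x 0.
Definition Cadd (a b : C) : C := mkC (Cre a + Cre b) (Cim a + Cim b).
Definition Cmul (a b : C) : C :=
  mkC (Cre a * Cre b - Cim a * Cim b) (Cre a * Cim b + Cim a * Cre b).
Definition Cconj (a : C) : C := mkC (Cre a) (- Cim a).

Fixpoint Csum (n : nat) (f : nat -> C) : C :=
  match n with O => C0 | S k => Cadd (Csum k f) (f k) end.

(* ---------- n x n complex matrices ----------
   A matrix of M_n is a function nat -> nat -> C of which only the entries
   with indices i, j < n are meaningful; all notions below only inspect
   those entries. *)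
Definition Mat := nat -> nat -> C.
Definition Vec := nat -> C.

Definition mzero : Mat := fun _ _ => C0.
Definition mid : Mat := fun i j => if Nat.eqb i j then C1 else C0.
Definition madd (A B : Mat) : Mat := fun i j => Cadd (A i j) (B i j).
Definition mmul (n : nat) (A B : Mat) : Mat :=
  fun i j => Csum n (fun k => Cmul (A i k) (B k j)).
Definition madj (A : Mat) : Mat := fun i j => Cconj (A j i).
Definition mdiag (d : nat -> R) : Mat :=
  fun i j => if Nat.eqb i j then RtoC (d i) else C0.
Fixpoint msum (m : nat) (F : nat -> Mat) : Mat :=
  match m with O => mzero | S k => madd (msum k F) (F k) end.

Definition meq (n : nat) (A B : Mat) : Prop :=
  forall i j, (i < n)%nat -> (j < n)%nat -> A i j = B i j.

Definition trace (n : nat) (A : Mat) : C := Csum n (fun i => A i i).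

Definition invertible (n : nat) (X : Mat) : Prop :=
  exists Y, meq n (mmul n X Y) mid /\ meq n (mmul n Y X) mid.

Definition unitary (n : nat) (U : Mat) : Prop :=
  meq n (mmul n U (madj U)) mid /\ meq n (mmul n (madj U) U) mid.

Definition hermitian (n : nat) (A : Mat) : Prop := meq n (madj A) A.

Definition qform (n : nat) (A : Mat) (v : Vec) : C :=
  Csum n (fun i => Csum n (fun j => Cmul (Cconj (v i)) (Cmul (A i j) (v j)))).

Definition posdef (n : nat) (A : Mat) : Prop :=
  hermitian n A /\
  forall v : Vec, (exists i, (i < n)%nat /\ v i <> C0) -> Cre (qform n A v) > 0.

Definition is_fcalc (n : nat) (f : R -> R) (H F : Mat) : Prop :=
  exists (U : Mat) (d : nat -> R),
    unitary n U /\
    meq n H (mmul n U (mmul n (mdiag d) (madj U))) /\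
    meq n F (mmul n U (mmul n (mdiag (fun i => f (d i))) (madj U))).

(* f(H), chosen by Hilbert's epsilon (it is unique whenever it exists, which is
   the case for every Hermitian H by the spectral theorem). *)
Definition fcalc (n : nat) (f : R -> R) (H : Mat) : Mat :=
  epsilon (inhabits mzero) (fun F => is_fcalc n f H F).

Definition mpow (n : nat) (A : Mat) (t : R) : Mat :=
  fcalc n (fun x => Rpower x t) A.

(* Tr phi(H), a real number for Hermitian H *)
Definition trfun (n : nat) (phi : R -> R) (H : Mat) : R :=
  Cre (trace n (fcalc n phi H)).

(* Main.v *)
(* Diagonalizing A_i = U_i D_i U_i^* turns H(t) = sum_i X_i^* A_i^(t_i) X_i into
   sum_l e^(x_l(t)) y_l y_l^* with fixed vectors y_l and exponents x_l linear in
   t. For an isometry Q^* of C^k into C^n, Cauchy-Binet writes det (Q H(t) Q^* )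
   as a nonnegative combination of exponentials of linear functions of t, hence
   as a log-convex function of t; the same formula in an eigenbasis of H(t)
   bounds it by the product over j of max (lambda_j, e^tau), up to the factor
   e^((k - n) tau). Taking for Q the eigenvectors of the middle matrix with
   eigenvalue above e^tau shows that sum_j max (log lambda_j - tau, 0) is convex
   in t for every tau. On a finite set of points, every convex nondecreasing
   function is a constant plus a nonnegative combination of such hinges, and
   phi (exp u) is one. *)
Require Import Defs.
From Stdlib Require Import Reals.
From Stdlib Require ClassicalEpsilon.
From mathcomp Require all_boot all_order all_fingroup all_algebra complex Rstruct ring lra.
Open Scope R_scope.

Module TraceConvexity.
Import all_boot all_order all_fingroup all_algebra complex Rstruct ring lra.
Import Order.TTheory GRing.Theory Num.Theory.
Set Implicit Arguments.
Unset Strict Implicit.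
Local Open Scope complex_scope.
Local Open Scope sesquilinear_scope.
Local Open Scope ring_scope.

Local Notation R := Rdefinitions.R.

(* Stdlib would parse these arguments in [R_scope]. *)
Local Arguments Rtrigo_def.exp x%_ring_scope.
Bind Scope ring_scope with Rdefinitions.R.

(** * Cauchy-Binet and determinants of Gram matrices *)

(** Multilinearity expands the determinant over all maps [f]; summing over the compositions of [f]
    with permutations turns the product of entries of [V] into a determinant. The factor k! appears
    because [f] runs over maps, not subsets. *)
Lemma cauchy_binet (K : comNzRingType) (k : nat) (L : finType)
    (V W : 'I_k -> L -> K) (d : L -> K) :
  k`!%:R * \det (\matrix_(p, q) \sum_l V p l * d l * W q l) =
  \sum_(f : {ffun 'I_k -> L}) (\prod_i d (f i)) *
    (\det (\matrix_(p, i) V p (f i)) * \det (\matrix_(q, i) W q (f i))).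
Proof.
set M := \matrix_(p, q) _.
have detM : \det M = \sum_(f : {ffun 'I_k -> L}) (\prod_i d (f i)) *
    ((\prod_i V i (f i)) * \det (\matrix_(q, i) W q (f i))).
  rewrite /M /determinant.
  under eq_bigr => s _.
    under eq_bigr => i _ do rewrite mxE.
    rewrite bigA_distr_bigA /= mulr_sumr; over.
  rewrite exchange_big /=; apply: eq_bigr => f _.
  rewrite -[\sum_(s : 'S_k) _ in RHS]/(\det _) -det_tr /determinant.
  rewrite !mulr_sumr; apply: eq_bigr => s _.
  under [X in _ = _ * (_ * (_ * X))]eq_bigr => i _ do rewrite !mxE.
  rewrite !big_split /= [_ * \prod_i d _]mulrC -!mulrA [LHS]mulrCA.
  by congr (_ * _); exact: mulrCA.
rewrite -card_Sn -sum1_card natr_sum mulr_suml.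
under eq_bigr => s _.
  rewrite mul1r detM (reindex_inj (h := fun f : {ffun 'I_k -> L} =>
    [ffun i => f (s i)])) /=; last first.
    move=> f g /ffunP fg; apply/ffunP => i.
    by have := fg (s^-1 i)%g; rewrite !ffunE permKV.
  over.
rewrite exchange_big /=; apply: eq_bigr => f _.
rewrite [in X in _ * (X * _)]/determinant mulr_suml mulr_sumr.
apply: eq_bigr => s _.
(* The sign of [s] from the permuted columns of [W] completes the Leibniz expansion of the minor of
   [V]. *)
have -> : \matrix_(q, i) W q ([ffun i => f (s i)] i) =
    col_perm s (\matrix_(q, i) W q (f i)).
  by apply/matrixP => q i; rewrite !mxE ffunE.
rewrite col_permE det_mulmx det_perm.
rewrite [X in X * _ = _](_ : _ = \prod_i d (f i)); last first.
  by rewrite [RHS](reindex_inj (@perm_inj _ s)); apply: eq_bigr => i _; rewrite ffunE.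
under [X in _ * (X * _) = _]eq_bigr => i _ do rewrite ffunE.
under [X in _ = _ * (_ * X * _)]eq_bigr => i _ do rewrite mxE.
rewrite odd_permV; congr (_ * _).
by rewrite mulrA [LHS]mulrC mulrA.
Qed.

(** For [W] the conjugate of [V] the two minors in Cauchy-Binet are conjugate, so the weight of [f]
    is a squared modulus over k!; a repeated index repeats a column. The weights depend on [P]
    alone, which allows [d] to vary later. *)
Lemma det_gram_weights (k : nat) (L : finType) (P : 'I_k -> L -> R[i]) :
  exists w : {ffun 'I_k -> L} -> R,
  [/\ forall f, 0 <= w f, forall f : {ffun 'I_k -> L}, ~~ injectiveb f -> w f = 0 &
   forall d : L -> R,
    \det (\matrix_(p, q) \sum_l P p l * (d l)%:C * (P q l)^*) =
    (\sum_(f : {ffun 'I_k -> L}) (\prod_i d (f i)) * w f)%:C].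
Proof.
pose D (f : {ffun 'I_k -> L}) := \det (\matrix_(p, i) P p (f i)).
exists (fun f => ((complex.Re (D f)) ^+ 2 + (complex.Im (D f)) ^+ 2) / k`!%:R); split=> [f|f|d].
- by rewrite divr_ge0 ?addr_ge0 ?sqr_ge0.
- move/injectivePn => [i [j ij fij]].
  suff -> : D f = 0 by rewrite /= expr0n addr0 mul0r.
  rewrite /D -det_tr; apply: (determinant_alternate ij) => q.
  by rewrite !mxE fij.
have k0 : (k`!%:R : R[i]) != 0 by rewrite pnatr_eq0 -lt0n fact_gt0.
apply: (mulfI k0); rewrite cauchy_binet.
rewrite -[k`!%:R in RHS](rmorph_nat (real_complex R)) -rmorphM /=.
rewrite mulr_sumr rmorph_sum /=; apply: eq_bigr => f _.
have -> : k`!%:R * (\prod_i d (f i) * ((complex.Re (D f) ^+ 2 + complex.Im (D f) ^+ 2) / k`!%:R)) =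
   (\prod_i d (f i)) * (complex.Re (D f) ^+ 2 + complex.Im (D f) ^+ 2).
  by field; rewrite pnatr_eq0 -lt0n fact_gt0.
rewrite rmorphM rmorph_prod; congr (_ * _).
transitivity (`|D f| ^+ 2); last by rewrite -add_Re2_Im2.
rewrite normCK; congr (_ * _).
rewrite /D -det_map_mx; congr (\det _).
by apply/matrixP => p i; rewrite !mxE.
Qed.

(** * Log-convexity of sums of exponentials *)

Lemma mul_exp (x y : R) : exp x * exp y = exp (x + y).
Proof. exact/esym/exp_plus. Qed.

Lemma expRN (x : R) : exp (- x) = (exp x)^-1.
Proof. exact: exp_Ropp. Qed.

Lemma expR_gt0 (x : R) : 0 < exp x.
Proof. exact/RltP/exp_pos. Qed.

Lemma ler_expR (x y : R) : (exp x <= exp y) = (x <= y).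
Proof.
have lt_exp (u v : R) : u < v -> exp u < exp v.
  by move=> /RltP uv; apply/RltP/exp_increasing.
by apply: (le_mono (f := exp)).
Qed.

Lemma exp_convex (lam x z : R) : 0 <= lam <= 1 ->
  exp (lam * x + (1 - lam) * z) <= lam * exp x + (1 - lam) * exp z.
Proof.
move=> /andP[lam0 lam1]; set m := lam * x + _.
(* The tangent of [exp] at [m] lies below the graph, and its values at [x] and [z] average to
   [exp m]. *)
have tangent t : exp m * (1 + (t - m)) <= exp t.
  have -> : exp t = exp m * exp (t - m) by rewrite mul_exp addrC subrK.
  rewrite ler_pM2l; last exact: expR_gt0.
  exact/RleP/exp_ineq1_le.
have hx := tangent x; have hz := tangent z.
have : lam * (exp m * (1 + (x - m))) + (1 - lam) * (exp m * (1 + (z - m))) <=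
    lam * exp x + (1 - lam) * exp z.
  by apply: lerD; apply: ler_wpM2l => //; lra.
suff -> : lam * (exp m * (1 + (x - m))) + (1 - lam) * (exp m * (1 + (z - m))) = exp m by [].
by rewrite /m; ring.
Qed.

Lemma prod_exp (I : finType) (x : I -> R) : \prod_i exp (x i) = exp (\sum_i x i).
Proof.
by symmetry; apply: (big_morph exp (id1 := 1) (op1 := *%R)) => [u v|];
  rewrite ?mul_exp ?expR0.
Qed.

(** Dividing by [exp a] and [exp b] turns both hypotheses into sums at most 1, after which convexity
    of [exp] applies termwise. Upper bounds [a], [b] in place of logarithms also cover sums that
    vanish. *)
Lemma exp_sum_log_convex (I : finType) (w x z : I -> R) (lam a b : R) :
  0 <= lam <= 1 -> (forall i, 0 <= w i) ->
  \sum_i exp (x i) * w i <= exp a -> \sum_i exp (z i) * w i <= exp b ->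
  \sum_i exp (lam * x i + (1 - lam) * z i) * w i <= exp (lam * a + (1 - lam) * b).
Proof.
move=> lam01 w0 hx hz; have /andP[lam0 lam1] := lam01.
have rescale (u : I -> R) c : \sum_i exp (u i) * w i <= exp c ->
    \sum_i exp (u i - c) * w i <= 1.
  move=> hu; under eq_bigr => i _ do rewrite addrC -mul_exp -mulrA.
  rewrite -mulr_sumr; have -> : 1 = exp (- c) * exp c by rewrite mul_exp addNr expR0.
  by rewrite ler_pM2l // expR_gt0.
have {}hx := rescale _ _ hx; have {}hz := rescale _ _ hz.
set c := lam * a + _.
rewrite -[leRHS]mulr1 -ler_pdivrMl; last exact: expR_gt0.
rewrite mulr_sumr.
apply: (@le_trans _ _ (\sum_i (lam * (exp (x i - a) * w i) +
    (1 - lam) * (exp (z i - b) * w i)))).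
  apply: ler_sum => i _; rewrite [leRHS](_ : _ =
    (lam * exp (x i - a) + (1 - lam) * exp (z i - b)) * w i); last by ring.
  rewrite mulrA; apply: ler_wpM2r => //; apply: le_trans (exp_convex _ _ lam01).
  rewrite -expRN mul_exp le_eqVlt; apply/orP; left; apply/eqP.
  by congr exp; rewrite /c; ring.
rewrite big_split /= -!mulr_sumr.
have : lam * (\sum_i exp (x i - a) * w i) <= lam * 1 by apply: ler_wpM2l.
have : (1 - lam) * (\sum_i exp (z i - b) * w i) <= (1 - lam) * 1.
  by apply: ler_wpM2l => //; lra.
lra.
Qed.

(** * Interpolation by hinges and majorization *)

(* In [sorted_case], [g] is affine with slope [sl] to the right of the last point,
   so that one more hinge there makes it agree with [psi] at the next one. *)
Lemma convex_interpolation (good : (R -> R) -> Prop) (psi : R -> R) :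
  (forall c, good (fun=> c)) ->
  (forall g tau w, 0 <= w -> good g ->
    good (fun x => g x + w * Num.max (x - tau) 0)) ->
  {homo psi : x y / x <= y} ->
  (forall x y lam, 0 <= lam <= 1 ->
    psi (lam * x + (1 - lam) * y) <= lam * psi x + (1 - lam) * psi y) ->
  forall s : seq R, exists2 g, good g & {in s, g =1 psi}.
Proof.
move=> good_cst good_hinge psi_mono psi_conv.
have sorted_case p s : path <=%R p s -> exists g sl,
    [/\ good g, 0 <= sl, {in p :: s, forall x, x <= last p s /\ g x = psi x},
        forall x, last p s <= x -> g x = psi (last p s) + sl * (x - last p s) &
        forall x, last p s <= x -> psi (last p s) + sl * (x - last p s) <= psi x].
  elim/last_ind: s => [_|s q IH].
    (* The constant [psi p] extends to the right with slope 0, below [psi] by monotonicity. *)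
    exists (fun=> psi p), 0; split=> //= [x|x _|x px].
    - by rewrite inE => /eqP ->.
    - by rewrite mul0r addr0.
    - by rewrite mul0r addr0 psi_mono.
  rewrite rcons_path last_rcons => /andP[/IH [g [sl [gg sl0 gs gr gb]]]].
  set r := last p s in gs gr gb *; rewrite le_eqVlt => /orP[/eqP <-|rq].
    exists g, sl; split=> // x; rewrite -rcons_cons mem_rcons inE.
    by case/orP => [/eqP ->|/gs //]; split=> //; rewrite gr // subrr mulr0 addr0.
  have qr0 : 0 < q - r by rewrite subr_gt0.
  pose sl' := (psi q - psi r) / (q - r).
  have slE : sl' * (q - r) = psi q - psi r by rewrite divfK // gt_eqF.
  have psiq : psi q = psi r + sl' * (q - r) by rewrite slE addrC subrK.
  (* The old extension lies below [psi] at [q], so the chord from [r] to [q] is at least as steep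
     and the new hinge has nonnegative weight. *)
  have sll : sl <= sl'.
    by rewrite ler_pdivlMr // lerBrDl; apply/gb/ltW.
  exists (fun x => g x + (sl' - sl) * Num.max (x - r) 0), sl'; split.
  - by apply: good_hinge => //; rewrite subr_ge0.
  - exact: le_trans sl0 sll.
  - move=> x; rewrite -rcons_cons mem_rcons inE => /orP[/eqP -> | /gs [xr ->]].
      split=> //; rewrite gr ?ltW // max_l ?ltW //.
      by rewrite psiq; ring.
    split; first by apply: le_trans xr _; apply: ltW.
    by rewrite max_r ?mulr0 ?addr0 // subr_le0.
  - move=> x qx; have rx : r <= x by apply: le_trans qx; apply: ltW.
    rewrite gr // max_l ?subr_ge0 //.
    by rewrite psiq; ring.
  - move=> y; rewrite le_eqVlt => /orP[/eqP <-|qy].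
      by rewrite subrr mulr0 addr0.
    have ry : 0 < y - r by rewrite subr_gt0; apply: lt_trans qy.
    have yr0 : y - r != 0 by rewrite gt_eqF.
    (* Here [q] is a convex combination of [r] and [y] with weight [(y - q) / (y - r)] on [r];
       convexity puts [psi y] above the extended chord. *)
    have t01 : 0 <= (y - q) / (y - r) <= 1.
      by rewrite ler_pdivlMr // ler_pdivrMr //; apply/andP; split; lra.
    have := psi_conv r y _ t01.
    have -> : (y - q) / (y - r) * r + (1 - (y - q) / (y - r)) * y = q by field.
    move=> h; have {h} : (y - r) * psi q <= (y - q) * psi r + (q - r) * psi y.
      have -> : (y - q) * psi r + (q - r) * psi y =
        (y - r) * ((y - q) / (y - r) * psi r + (1 - (y - q) / (y - r)) * psi y) by field.
      by rewrite ler_pM2l.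
    move=> h; rewrite -(ler_pM2l qr0) mulrDr mulrA [(q - r) * sl']mulrC slE.
    move: h; rewrite !mulrBl !mulrBr; lra.
move=> s; have := sort_sorted le_total s; case E: (sort _ s) => [|p s'].
  exists (fun=> 0) => // x; have : perm_eq (sort <=%R s) s by rewrite perm_sort.
  by move/perm_mem => <-; rewrite E.
move=> /= /sorted_case [g [sl [gg _ gs _ _]]]; exists g => // x.
by rewrite -(mem_sort <=%R) E => /gs [].
Qed.

(** Only the values of [psi] at the finitely many points of [a], [b], [c] matter, so an interpolant
    may replace it. The inequality is an equality for constants and survives adding nonnegative
    multiples of hinges. *)
Lemma hinge_majorization (n : nat) (a b c : 'I_n -> R) (lam : R) (psi : R -> R) :
  (forall tau, \sum_j Num.max (c j - tau) 0 <=
    lam * (\sum_j Num.max (a j - tau) 0) +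
    (1 - lam) * (\sum_j Num.max (b j - tau) 0)) ->
  {homo psi : x y / x <= y} ->
  (forall x y t, 0 <= t <= 1 ->
    psi (t * x + (1 - t) * y) <= t * psi x + (1 - t) * psi y) ->
  \sum_j psi (c j) <= lam * (\sum_j psi (a j)) + (1 - lam) * (\sum_j psi (b j)).
Proof.
move=> hinge psi_mono psi_conv.
pose good (g : R -> R) := \sum_j g (c j) <=
  lam * (\sum_j g (a j)) + (1 - lam) * (\sum_j g (b j)).
have [||g gg gE] := @convex_interpolation good psi _ _ psi_mono psi_conv
    (codom a ++ codom b ++ codom c).
- by move=> k; rewrite /good -mulrDl addrC subrK mul1r.
- move=> g tau w w0; rewrite /good => gg.
  rewrite !big_split /= -!mulr_sumr.
  have := ler_wpM2l w0 (hinge tau); rewrite mulrDr => h.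
  apply: le_trans (lerD gg h) _.
  by rewrite le_eqVlt; apply/orP; left; apply/eqP; ring.
move: gg; rewrite /good.
under eq_bigr => j _ do rewrite gE ?mem_cat ?codom_f ?orbT //.
under [X in _ <= lam * X + _]eq_bigr => j _ do rewrite gE ?mem_cat ?codom_f ?orbT //.
by under [X in _ <= _ + _ * X]eq_bigr => j _ do rewrite gE ?mem_cat ?codom_f ?orbT //.
Qed.

(** * Gram matrices and their compressions *)

(** The inner index lives in an arbitrary finite type so that pairs can label the columns of [P]. *)
Definition gram (k : nat) (L : finType) (P : 'I_k -> L -> R[i]) (d : L -> R) :
    'M[R[i]]_k := \matrix_(p, q) \sum_l P p l * (d l)%:C * (P q l)^*.

Definition cdiag (n : nat) (d : 'I_n -> R) : 'M[R[i]]_n :=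
  diag_mx (\row_j (d j)%:C).

Lemma gram_diag (k n : nat) (A : 'M[R[i]]_(k, n)) (d : 'I_n -> R) :
  A *m cdiag d *m A^t* = gram A d.
Proof.
apply/matrixP => p q; rewrite mul_mx_diag !mxE; apply: eq_bigr => l _.
by rewrite !mxE.
Qed.

Lemma gram_adj (k : nat) (L : finType) (P : 'I_k -> L -> R[i]) (d : L -> R) :
  (gram P d)^t* = gram P d.
Proof.
apply/matrixP => p q; rewrite !mxE rmorph_sum.
apply: eq_bigr => l _; rewrite !rmorphM /= conjCK mulrC mulrA mulrAC.
by rewrite -[Num.conj _]/((d l)%:C^*)%C conjc_real mulrAC.
Qed.

Lemma mul_gram (k n : nat) (L : finType) (Q : 'M[R[i]]_(k, n))
    (P : 'I_n -> L -> R[i]) (d : L -> R) :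
  Q *m gram P d *m Q^t* = gram (fun p l => \sum_j Q p j * P j l) d.
Proof.
apply/matrixP => p q; rewrite !mxE.
under eq_bigr => j _.
  rewrite !mxE mulr_suml.
  under eq_bigr => i _ do rewrite mxE mulr_sumr mulr_suml.
  over.
rewrite /= (eq_bigr _ (fun j _ => exchange_big _ _ _ _ _ _)) /= exchange_big /=.
apply: eq_bigr => l _.
rewrite rmorph_sum /= mulr_sumr; apply: eq_bigr => j _.
rewrite mulr_suml mulr_suml; apply: eq_bigr => i _.
by rewrite rmorphM /= !mulrA; ring.
Qed.

Lemma sum_comp_inj_le (I J : finType) (f : I -> J) (g : J -> R) :
  injective f -> (forall j, 0 <= g j) -> \sum_i g (f i) <= \sum_j g j.
Proof.
move=> finj g0; rewrite -(big_imset g (in2W finj)) /=.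
by rewrite [leRHS](bigID (mem [set f i | i in I])) /= lerDl sumr_ge0.
Qed.

(** The rows of [Q *m V] are orthonormal, so the determinant is a weighted mean of products of [k]
    eigenvalues. Only injective [f] carry weight, so each exponent occurs at most once in a product,
    and the hinges bound the excess over [tau]. *)
Lemma det_compression_bound (k n : nat) (Q : 'M[R[i]]_(k, n)) (V : 'M[R[i]]_n)
    (al : 'I_n -> R) (tau : R) :
  Q *m Q^t* = 1%:M -> V *m V^t* = 1%:M ->
  complex.Re (\det (Q *m (V *m cdiag (fun j => exp (al j)) *m V^t*) *m Q^t*)) <=
    exp (k%:R * tau + \sum_j Num.max (al j - tau) 0).
Proof.
move=> QQ VV; have QV : (Q *m V) *m (Q *m V)^t* = 1%:M.
  by rewrite trmx_mul map_mxM mulmxA -(mulmxA Q) VV mulmx1.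
have -> d : Q *m (V *m cdiag d *m V^t*) *m Q^t* = gram (Q *m V) d.
  by rewrite -gram_diag trmx_mul map_mxM !mulmxA.
have [w [w0 winj detE]] := det_gram_weights (Q *m V).
rewrite /gram detE /=.
(* With [d] constantly 1 the Gram matrix is the identity. *)
have w1 : \sum_f w f = 1.
  apply: complexI; transitivity (\det (1%:M : 'M[R[i]]_k)); last by rewrite det1.
  rewrite -QV -[X in X *m _]mulmx1.
  have -> : 1%:M = cdiag (fun=> 1) :> 'M_n.
    by apply/matrixP => i j; rewrite !mxE.
  rewrite gram_diag /gram detE; congr (_%:C).
  by apply: eq_bigr => f _; rewrite big1 ?mul1r.
set B := exp _; rewrite -[leRHS]mulr1 -[X in _ <= _ * X]w1 mulr_sumr; apply: ler_sum => f _.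
have [/injectiveP finj|/winj ->] := boolP (injectiveb f); last by rewrite !mulr0.
apply: ler_wpM2r => //; rewrite (prod_exp (fun i => al (f i))).
have -> : \sum_i al (f i) = k%:R * tau + \sum_i (al (f i) - tau).
  by rewrite sumrB sumr_const card_ord -[tau *+ k]mulr_natl addrC subrK.
rewrite /B ler_expR; apply: lerD => //.
apply: (@le_trans _ _ (\sum_i Num.max (al (f i) - tau) 0)).
  by apply: ler_sum => i _; rewrite le_max lexx.
apply: (sum_comp_inj_le (g := fun j => Num.max (al j - tau) 0)) => // j.
by rewrite le_max lexx orbT.
Qed.

(* [Q] compresses to the eigenvectors of the middle matrix whose eigenvalue
   exceeds [exp tau]. *)
Lemma hinge_log_convex (n : nat) (L : finType) (P : 'I_n -> L -> R[i])
    (x z : L -> R) (lam : R) (U V W : 'M[R[i]]_n) (al be ga : 'I_n -> R) :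
  0 <= lam <= 1 ->
  U *m U^t* = 1%:M -> V *m V^t* = 1%:M -> W *m W^t* = 1%:M ->
  gram P (fun l => exp (x l)) = U *m cdiag (fun j => exp (al j)) *m U^t* ->
  gram P (fun l => exp (z l)) = V *m cdiag (fun j => exp (be j)) *m V^t* ->
  gram P (fun l => exp (lam * x l + (1 - lam) * z l)) =
    W *m cdiag (fun j => exp (ga j)) *m W^t* ->
  forall tau, \sum_j Num.max (ga j - tau) 0 <=
    lam * (\sum_j Num.max (al j - tau) 0) +
    (1 - lam) * (\sum_j Num.max (be j - tau) 0).
Proof.
move=> lam01 UU VV WW eqU eqV eqW tau.
pose S := [pred j | tau < ga j]; pose k := #|S|.
pose g (p : 'I_k) : 'I_n := enum_val p.
pose Q : 'M[R[i]]_(k, n) := \matrix_(p, j) (W j (g p))^*.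
have WW' : W^t* *m W = 1%:M by apply: mulmx1C.
have QW p j : (Q *m W) p j = (g p == j)%:R.
  have /matrixP/(_ (g p) j) := WW'; rewrite !mxE => <-.
  by apply: eq_bigr => i _; rewrite !mxE.
have gramW d : Q *m (W *m cdiag d *m W^t*) *m Q^t* =
    \matrix_(p, q) ((d (g p))%:C * (p == q)%:R).
  have -> : Q *m (W *m cdiag d *m W^t*) *m Q^t* = gram (Q *m W) d.
    by rewrite -gram_diag trmx_mul map_mxM !mulmxA.
  apply/matrixP => p q; rewrite !mxE (bigD1 (g p)) //= !QW eqxx mul1r.
  rewrite rmorph_nat big1 ?addr0 => [|j]; last first.
    by rewrite QW eq_sym => /negPf ->; rewrite !mul0r.
  by rewrite (inj_eq enum_val_inj) eq_sym.
have QQ : Q *m Q^t* = 1%:M.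
  have := gramW (fun=> 1).
  have -> : cdiag (fun=> 1) = 1%:M :> 'M_n.
    by apply/matrixP => i j; rewrite !mxE.
  rewrite mulmx1 WW mulmx1 => ->.
  by apply/matrixP => p q; rewrite !mxE mul1r.
(* One family of weights [w] serves all three matrices, since it does not depend on the
   exponents. *)
have [w [w0 _ detE]] := det_gram_weights (fun p l => \sum_j Q p j * P j l).
pose D d := \sum_(f : {ffun 'I_k -> L}) (\prod_i d (f i)) * w f.
have DE d : complex.Re (\det (Q *m gram P d *m Q^t*)) = D d.
  by rewrite mul_gram /gram detE.
have DexpE (u : L -> R) :
    D (fun l => exp (u l)) = \sum_(f : {ffun 'I_k -> L}) exp (\sum_i u (f i)) * w f.
  by apply: eq_bigr => f _; rewrite (prod_exp (fun i => u (f i))).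
have hx := det_compression_bound al tau QQ UU.
rewrite -eqU DE DexpE in hx.
have hz := det_compression_bound be tau QQ VV.
rewrite -eqV DE DexpE in hz.
have := exp_sum_log_convex lam01 w0 hx hz.
under eq_bigr => f _ do rewrite !mulr_sumr -big_split /=.
rewrite -(DexpE (fun l => lam * x l + (1 - lam) * z l)) -DE eqW gramW.
have -> : \matrix_(p, q) ((exp (ga (g p)))%:C * (p == q)%:R) =
    cdiag (fun p => exp (ga (g p))).
  by apply/matrixP => p q; rewrite !mxE mulr_natr.
rewrite det_diag.
under eq_bigr => p _ do rewrite mxE.
rewrite -rmorph_prod /= prod_exp ler_expR => hga.
(* [Q] keeps exactly the exponents above [tau], so for the middle matrix the compression bound is an
   equality. *)
have -> : \sum_j Num.max (ga j - tau) 0 = \sum_p ga (g p) - k%:R * tau.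
  rewrite (bigID (mem S)) /= [X in _ + X]big1 ?addr0 => [|j]; last first.
    by rewrite -leNgt -subr_le0 => /max_r.
  rewrite big_enum_val /= mulr_natl -[k in _ *+ k]card_ord -sumr_const -sumrB.
  apply: eq_bigr => p _; apply: max_l; rewrite subr_ge0.
  exact: ltW (enum_valP p).
lra.
Qed.

(** * Spectral theorem and functional calculus *)

Lemma hermitian_eigendecomposition (n : nat) (H : 'M[R[i]]_n) : H^t* = H ->
  exists (U : 'M[R[i]]_n) (d : 'I_n -> R),
    U *m U^t* = 1%:M /\ H = U *m cdiag d *m U^t*.
Proof.
move=> HH; have herm : H \is hermsymmx.
  by apply/is_hermitianmxP; rewrite expr0 scale1r HH.
have Su := spectral_unitarymx H.
exists ((spectralmx H)^t*), (fun j => complex.Re (spectral_diag H 0 j)); split.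
  by rewrite trmxCK; apply/mulmx1C/unitarymxP.
rewrite trmxCK -invmx_unitary //.
have /hermitian_normalmx/orthomx_spectralP {1}-> := herm.
congr (_ *m _ *m _); congr diag_mx; apply/rowP => j; rewrite mxE RRe_real //.
by have /mxOverP := hermitian_spectral_diag_real herm.
Qed.

(** The matrix [V^t* *m U] intertwines the two diagonal matrices: a nonzero entry at [i], [j] forces
    [d j = e i], hence equal values of [f]. *)
Lemma cdiag_calculus_unique (n : nat) (U V : 'M[R[i]]_n) (d e : 'I_n -> R)
    (f : R -> R) :
  U *m U^t* = 1%:M -> V *m V^t* = 1%:M ->
  U *m cdiag d *m U^t* = V *m cdiag e *m V^t* ->
  U *m cdiag (fun j => f (d j)) *m U^t* = V *m cdiag (fun j => f (e j)) *m V^t*.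
Proof.
move=> UU VV eqUV; have UU' := mulmx1C UU; have VV' := mulmx1C VV.
pose W := V^t* *m U.
have Wd : W *m cdiag d = cdiag e *m W.
  have := congr1 (fun M => V^t* *m M *m U) eqUV.
  by rewrite !mulmxA VV' mul1mx -!mulmxA UU' mulmx1 !mulmxA.
have Wf : W *m cdiag (fun j => f (d j)) = cdiag (fun j => f (e j)) *m W.
  move: Wd; clearbody W => /matrixP Wd; apply/matrixP => i j.
  have := Wd i j; rewrite !mul_mx_diag !mul_diag_mx !mxE.
  have [->|nz] := eqVneq (W i j) 0; first by rewrite !mul0r !mulr0.
  by rewrite mulrC => /(mulIf nz)/complexI ->; rewrite mulrC.
have -> : U *m cdiag (fun j => f (d j)) *m U^t* =
    V *m (W *m cdiag (fun j => f (d j))) *m U^t* by rewrite /W !mulmxA VV mul1mx.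
by rewrite Wf /W !mulmxA -[_ *m U *m _]mulmxA UU mulmx1.
Qed.

(** In the eigenbasis, [d j] is a sum over [l] of [w l] times the squared modulus of row [j] of
    [U^t*] paired with column [l] of [P]. If it vanished, that row would be zero by injectivity,
    against unitarity. *)
Lemma gram_eigenvalue_gt0 (n : nat) (L : finType) (P : 'I_n -> L -> R[i])
    (w : L -> R) (U : 'M[R[i]]_n) (d : 'I_n -> R) :
  (forall l, 0 < w l) ->
  (forall v : 'rV[R[i]]_n, (forall l, \sum_p v 0 p * P p l = 0) -> v = 0) ->
  U *m U^t* = 1%:M -> gram P w = U *m cdiag d *m U^t* -> forall j, 0 < d j.
Proof.
move=> w0 Pinj UU eqU j; have UU' := mulmx1C UU.
have dE : (d j)%:C = \sum_l `|\sum_p (U^t*) j p * P p l| ^+ 2 * (w l)%:C.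
  have : U^t* *m gram P w *m (U^t*)^t* = cdiag d.
    by rewrite eqU trmxCK !mulmxA UU' mul1mx -mulmxA UU' mulmx1.
  move=> /matrixP/(_ j j); rewrite mul_gram !mxE eqxx mulr1n => <-.
  by apply: eq_bigr => l _; rewrite normCK mulrAC.
have ge0 l : 0 <= `|\sum_p (U^t*) j p * P p l| ^+ 2 * (w l)%:C.
  by rewrite mulr_ge0 ?exprn_ge0 // ler0c ltW.
rewrite -ltcR dE lt_def sumr_ge0 // andbT; apply/negP.
rewrite psumr_eq0 // => /allP all0.
have row0 : row j (U^t*) = 0.
  apply: Pinj => l; have := all0 l (mem_index_enum l).
  rewrite /= mulf_eq0 expf_eq0 /= normr_eq0 => /orP[/eqP {2}<-|].
    by apply: eq_bigr => p _; rewrite mxE.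
  by move=> /eqP/complexI w00; have := w0 l; rewrite w00 ltxx.
have /matrixP/(_ j j) := UU'; rewrite !mxE eqxx => /eqP; rewrite eq_sym big1 ?oner_eq0 //.
by move=> p _; have /rowP/(_ p) := row0; rewrite !mxE => ->; rewrite mul0r.
Qed.

(** * Translation between the two models of complex matrices *)

Definition toC (a : Defs.C) : R[i] := Cre a +i* Cim a.
Definition ofC (z : R[i]) : Defs.C := mkC (complex.Re z) (complex.Im z).
Definition toM (n : nat) (A : Mat) : 'M[R[i]]_n := \matrix_(i, j) toC (A i j).
Definition ofM (n : nat) (A : 'M[R[i]]_n) : Mat := fun i j =>
  if (insub i, insub j) is (Some p, Some q) then ofC (A p q) else C0.

Lemma toC_inj : injective toC.
Proof. by move=> [a b] [c d] [-> ->]. Qed.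

Lemma ofCK : cancel ofC toC. Proof. by case. Qed.

Lemma toC_mul a b : toC (Cmul a b) = toC a * toC b. Proof. by []. Qed.

Lemma toC_conj a : toC (Cconj a) = (toC a)^*. Proof. by []. Qed.

Lemma toC_sum n f : toC (Csum n f) = \sum_(i < n) toC (f i).
Proof. by elim: n => [|n IH]; rewrite ?big_ord0 // big_ord_recr /= -IH. Qed.

Lemma meqP n A B : meq n A B <-> toM n A = toM n B.
Proof.
split=> [AB|AB i j /ssrnat.ltP iN /ssrnat.ltP jN].
  by apply/matrixP => i j; rewrite !mxE AB //; apply/ssrnat.ltP.
by apply: toC_inj; move/matrixP/(_ (Ordinal iN) (Ordinal jN)): AB; rewrite !mxE.
Qed.

Lemma ofMK n : cancel (@ofM n) (toM n).
Proof. by move=> A; apply/matrixP => i j; rewrite mxE /ofM !valK ofCK. Qed.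

Lemma toM_mul n A B : toM n (mmul n A B) = toM n A *m toM n B.
Proof.
apply/matrixP => i j; rewrite !mxE toC_sum.
by apply: eq_bigr => k _; rewrite !mxE.
Qed.

Lemma toM_adj n A : toM n (madj A) = (toM n A)^t*.
Proof. by apply/matrixP => i j; rewrite !mxE toC_conj. Qed.

Lemma eqbE (n : nat) (i j : 'I_n) : Nat.eqb i j = (i == j).
Proof.
by apply/idP/eqP => [/PeanoNat.Nat.eqb_eq/val_inj|->]; rewrite ?PeanoNat.Nat.eqb_refl.
Qed.

Lemma toM_id n : toM n mid = 1%:M.
Proof. by apply/matrixP => i j; rewrite !mxE /mid eqbE; case: eqP. Qed.

Lemma toM_diag n d : toM n (mdiag d) = cdiag (fun j : 'I_n => d j).
Proof.
apply/matrixP => i j; rewrite !mxE /mdiag eqbE.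
by case: eqP => [->|]; rewrite ?mulr1n ?mulr0n.
Qed.

Lemma toM_sum n m F : toM n (msum m F) = \sum_(i < m) toM n (F i).
Proof.
elim: m => [|m IH]; first by rewrite big_ord0; apply/matrixP => i j; rewrite !mxE.
by rewrite big_ord_recr /= -IH; apply/matrixP => i j; rewrite !mxE.
Qed.

Lemma is_fcalcP n f H F : is_fcalc n f H F <->
  exists (U : 'M[R[i]]_n) (d : 'I_n -> R), [/\ U *m U^t* = 1%:M,
    toM n H = U *m cdiag d *m U^t* &
    toM n F = U *m cdiag (fun j => f (d j)) *m U^t*].
Proof.
split=> [[U [d [[/meqP UU _] [/meqP HE /meqP FE]]]]|[U [d [UU HE FE]]]].
  exists (toM n U), (fun j => d j); split.
  - by move: UU; rewrite toM_mul toM_adj toM_id.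
  - by rewrite HE !toM_mul toM_adj toM_diag mulmxA.
  - by rewrite FE !toM_mul toM_adj toM_diag mulmxA.
(* Eigenvalues indexed by ['I_n] are extended by 0 to all naturals. *)
pose e i := oapp d 0 (insub i).
exists (ofM U), e; split; [split|split]; apply/meqP;
  rewrite !toM_mul toM_adj ?toM_id ?toM_diag !ofMK //; first exact: mulmx1C UU.
- rewrite mulmxA HE; congr (_ *m cdiag _ *m _).
  by apply: boolp.funext => j; rewrite /e valK.
- rewrite mulmxA FE; congr (_ *m cdiag _ *m _).
  by apply: boolp.funext => j; rewrite /e valK.
Qed.

Lemma fcalcP n f H : (toM n H)^t* = toM n H -> is_fcalc n f H (fcalc n f H).
Proof.
move=> /hermitian_eigendecomposition [U [d [UU HE]]].
apply: ClassicalEpsilon.epsilon_spec; exists (ofM (U *m cdiag (fun j => f (d j)) *m U^t*)).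
by apply/is_fcalcP; exists U, d; rewrite ofMK.
Qed.

(** The diagonalization behind the epsilon choice need not be the given one; uniqueness of the
    calculus reconciles them. *)
Lemma toM_fcalc n f H (U : 'M[R[i]]_n) (d : 'I_n -> R) :
  U *m U^t* = 1%:M -> toM n H = U *m cdiag d *m U^t* ->
  toM n (fcalc n f H) = U *m cdiag (fun j => f (d j)) *m U^t*.
Proof.
move=> UU HE; have /(fcalcP f)/is_fcalcP[V [e [VV HE' ->]]] : (toM n H)^t* = toM n H.
  by rewrite HE gram_diag gram_adj.
by apply: cdiag_calculus_unique; rewrite // -HE' -HE.
Qed.

(** * Traces of matrix pencils *)

Lemma trace_cdiag (n : nat) (U : 'M[R[i]]_n) (d : 'I_n -> R) :
  U *m U^t* = 1%:M -> complex.Re (\tr (U *m cdiag d *m U^t*)) = \sum_j d j.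
Proof.
move=> UU; rewrite mxtrace_mulC mulmxA (mulmx1C UU) mul1mx mxtrace_diag.
by under eq_bigr => j _ do rewrite mxE; rewrite -rmorph_sum.
Qed.

Lemma trfunE n phi H (U : 'M[R[i]]_n) (d : 'I_n -> R) :
  U *m U^t* = 1%:M -> toM n H = U *m cdiag d *m U^t* ->
  trfun n phi H = \sum_j phi (d j).
Proof.
move=> UU HE; rewrite -(trace_cdiag _ UU) -(toM_fcalc phi UU HE).
rewrite /trfun -[LHS]/(complex.Re (toC _)) /trace toC_sum; congr (complex.Re _).
by apply: eq_bigr => i _; rewrite mxE.
Qed.

(** Concatenating the columns of all [Q i], labelled by pairs, merges the two sums; the whole pencil
    thus becomes one Gram matrix. *)
Lemma sum_gram (k n m : nat) (Q : 'I_m -> 'M[R[i]]_(k, n)) (d : 'I_m -> 'I_n -> R) :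
  \sum_i gram (Q i) (d i) =
  gram (fun p (l : 'I_m * 'I_n) => Q l.1 p l.2) (fun l => d l.1 l.2).
Proof.
apply/matrixP => p q; rewrite summxE mxE.
rewrite -(pair_bigA _ (fun i l => Q i p l * (d i l)%:C * (Q i q l)^*)) /=.
by apply: eq_bigr => i _; rewrite mxE.
Qed.

(** [Rpower] unfolds to [exp (t * ln x)], which makes the exponents linear in [t]. *)
Lemma mpowE n A (U : 'M[R[i]]_n) (d : 'I_n -> R) t :
  U *m U^t* = 1%:M -> toM n A = U *m cdiag d *m U^t* ->
  toM n (mpow n A t) = U *m cdiag (fun j => exp (t * ln (d j))) *m U^t*.
Proof. exact: toM_fcalc. Qed.

(** Strict positivity of the eigenvalues lets them be written as exponentials, whose exponents the
    hinge inequalities compare. *)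
Lemma trace_gram (n : nat) (L : finType) (P : 'I_n -> L -> R[i]) (x : L -> R)
    (phi : R -> R) (H : Mat) :
  (forall v : 'rV[R[i]]_n, (forall l, \sum_p v 0 p * P p l = 0) -> v = 0) ->
  toM n H = gram P (fun l => exp (x l)) ->
  exists (U : 'M[R[i]]_n) (al : 'I_n -> R), [/\ U *m U^t* = 1%:M,
    gram P (fun l => exp (x l)) = U *m cdiag (fun j => exp (al j)) *m U^t* &
    trfun n phi H = \sum_j phi (exp (al j))].
Proof.
move=> Pinj HE; have [U [d [UU GE]]] :=
  hermitian_eigendecomposition (gram_adj P (fun l => exp (x l))).
have d0 := gram_eigenvalue_gt0 (fun l => expR_gt0 (x l)) Pinj UU GE.
have dE : d = (fun j => exp (ln (d j))).
  by apply: boolp.funext => j; rewrite exp_ln //; apply/RltP.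
exists U, (fun j => ln (d j)); rewrite -dE; split=> //.
rewrite (trfunE phi UU (etrans HE GE)); apply: eq_bigr => j _.
by rewrite {1}dE.
Qed.

Lemma trfun_gram_convex (n : nat) (L : finType) (P : 'I_n -> L -> R[i])
    (x z : L -> R) (lam : R) (phi : R -> R) (Hx Hz Hm : Mat) :
  (forall a b, 0 < a -> a <= b -> phi a <= phi b) ->
  (forall a b t, 0 <= t <= 1 ->
    phi (exp (t * a + (1 - t) * b)) <= t * phi (exp a) + (1 - t) * phi (exp b)) ->
  0 <= lam <= 1 ->
  (forall v : 'rV[R[i]]_n, (forall l, \sum_p v 0 p * P p l = 0) -> v = 0) ->
  toM n Hx = gram P (fun l => exp (x l)) ->
  toM n Hz = gram P (fun l => exp (z l)) ->
  toM n Hm = gram P (fun l => exp (lam * x l + (1 - lam) * z l)) ->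
  trfun n phi Hm <= lam * trfun n phi Hx + (1 - lam) * trfun n phi Hz.
Proof.
move=> phi_mono phi_conv lam01 Pinj HxE HzE HmE.
have [U [al [UU eqU ->]]] := trace_gram phi Pinj HxE.
have [V [be [VV eqV ->]]] := trace_gram phi Pinj HzE.
have [W [ga [WW eqW ->]]] := trace_gram phi Pinj HmE.
apply: (hinge_majorization (psi := fun u => phi (exp u))) => [|a b ab|//].
  exact: hinge_log_convex lam01 UU VV WW eqU eqV eqW.
by apply: phi_mono; rewrite ?expR_gt0 ?ler_expR.
Qed.

Lemma trfun_pencil_convex (n m : nat) (phi : R -> R) (A X : nat -> Mat) :
  (forall a b, 0 < a -> a <= b -> phi a <= phi b) ->
  (forall a b t, 0 <= t <= 1 ->
    phi (exp (t * a + (1 - t) * b)) <= t * phi (exp a) + (1 - t) * phi (exp b)) ->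
  (forall i : 'I_m, posdef n (A i)) -> (forall i : 'I_m, invertible n (X i)) ->
  let F := fun t : nat -> R => trfun n phi (msum m (fun i =>
    mmul n (madj (X i)) (mmul n (mpow n (A i) (t i)) (X i)))) in
  forall (t s : nat -> R) (lam : R), 0 <= lam <= 1 ->
    F (fun i => lam * t i + (1 - lam) * s i) <= lam * F t + (1 - lam) * F s.
Proof.
move=> phi_mono phi_conv hA hX F t s lam lam01.
(* For [m = 0] the pencil is empty and [F] is constant; otherwise the block [ord0] exists and gives
   injectivity below. *)
case: m => [|m] in hA hX F *.
  by rewrite /F /= -mulrDl addrC subrK mul1r.
have herm (i : 'I_m.+1) : (toM n (A i))^t* = toM n (A i).
  by have [/meqP] := hA i; rewrite toM_adj.
have [U /fin_all_exists [d Ud]] :=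
  fin_all_exists (fun i => hermitian_eigendecomposition (herm i)).
pose Q (i : 'I_m.+1) := (toM n (X i))^t* *m U i.
pose P p (l : 'I_m.+1 * 'I_n) := Q l.1 p l.2.
pose x (u : nat -> R) (l : 'I_m.+1 * 'I_n) := u l.1 * ln (d l.1 l.2).
have pencilE u : toM n (msum m.+1 (fun i =>
    mmul n (madj (X i)) (mmul n (mpow n (A i) (u i)) (X i)))) =
    gram P (fun l => exp (x u l)).
  rewrite toM_sum -(sum_gram Q (fun i k => exp (u i * ln (d i k)))).
  apply: eq_bigr => i _; have [UU AE] := Ud i.
  rewrite !toM_mul toM_adj (mpowE _ UU AE) -gram_diag /Q.
  by rewrite trmx_mul map_mxM trmxCK !mulmxA.
apply: (trfun_gram_convex (P := P) (x := x t) (z := x s)) => //.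
  (* A vector orthogonal to all columns is killed by [Q ord0], a product of invertible matrices. *)
  move=> v vP; have vQ : v *m Q ord0 = 0.
    by apply/rowP => k; rewrite mxE (vP (ord0, k)) mxE.
  have [UU _] := Ud ord0; have [Y [_ /meqP YX]] := hX ord0.
  move: YX; rewrite toM_mul toM_id => /(congr1 (fun M => M^t*)).
  rewrite trmx_mul map_mxM trmx1 map_mx1 => XY.
  by rewrite -[v]mulmx1 -XY mulmxA -[_ *m (toM n (X _))^t*]mulmx1 -UU !mulmxA
    -[v *m _ *m _]mulmxA vQ !mul0mx.
rewrite pencilE; congr (gram P _); apply: boolp.funext => l.
by congr exp; rewrite /x mulrDl !mulrA.
Qed.

End TraceConvexity.

Theorem theorem1p1 (n m : nat) (phi : R -> R)
  (phi_mono : forall x y, 0 < x -> x <= y -> phi x <= phi y)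
  (phi_exp_convex : forall (a b lam : R), 0 <= lam <= 1 ->
      phi (exp (lam * a + (1 - lam) * b))
        <= lam * phi (exp a) + (1 - lam) * phi (exp b))
  (A X : nat -> Mat)
  (hA : forall i, (i < m)%nat -> posdef n (A i))
  (hX : forall i, (i < m)%nat -> invertible n (X i)) :
  let F := fun t : nat -> R =>
    trfun n phi (msum m (fun i => mmul n (madj (X i)) (mmul n (mpow n (A i) (t i)) (X i)))) in
  forall (t s : nat -> R) (lam : R), 0 <= lam <= 1 ->
    F (fun i => lam * t i + (1 - lam) * s i) <= lam * F t + (1 - lam) * F s.
Proof.
intros F t s lam lam01.
destruct lam01 as [lam0 lam1].
(* What remains is the passage between propositional and boolean order on the reals. *)
apply (ssrbool.elimT Rstruct.RleP).
refine (TraceConvexity.trfun_pencil_convex (m := m) _ _ _ _ t s _).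
- intros a b a0 ab; apply (ssrbool.introT Rstruct.RleP), phi_mono.
  + exact (ssrbool.elimT Rstruct.RltP a0).
  + exact (ssrbool.elimT Rstruct.RleP ab).
- intros a b u u01; apply (ssrbool.introT Rstruct.RleP), phi_exp_convex.
  destruct (ssrbool.elimT ssrbool.andP u01) as [u0 u1]; split.
  + exact (ssrbool.elimT Rstruct.RleP u0).
  + exact (ssrbool.elimT Rstruct.RleP u1).
- intros i; apply hA, (ssrbool.elimT ssrnat.ltP (fintype.ltn_ord i)).
- intros i; apply hX, (ssrbool.elimT ssrnat.ltP (fintype.ltn_ord i)).
- apply (ssrbool.introT ssrbool.andP); split.
  + exact (ssrbool.introT Rstruct.RleP lam0).
  + exact (ssrbool.introT Rstruct.RleP lam1).
Qed.
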